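(* Let $T,\theta,R>0$, $\alpha>1$, $\lambda,\mu>0$, and let $f_T$, $t_0$ and the abandonment time $t^*$ be as defined in the context. (a) If $t_0\le0$, then $$t^*=\begin{cases}0&\text{if } f_T(0)>\frac{R}{\theta^\alpha},\\ T&\text{otherwise.}\end{cases}$$ (b) If $t_0>0$, then $$t^*=\begin{cases}0&\text{if } f_T(0)>\frac{R}{\theta^\alpha},\\ t'&\text{if } f_T(0)\le\frac{R}{\theta^\alpha}<f_T(t_0),\\ T&\text{otherwise,}\end{cases}$$ where $t'\in[0,t_0]$ is the unique value satisfying $f_T(t')=\frac{R}{\theta^\alpha}$.
   Context: For $t\in[0,T)$, $$\eta(t):=\int_0^t\frac{ds}{\bigl(1+\lambda(T-s)\bigr)^{\frac{\mu}{\lambda(\alpha-1)}+1}-1},$$ $$f_T(t):=\left(\frac{\mu+\lambda(\alpha-1)}{(\alpha-1)\left[\bigl(1+\lambda(T-t)\bigr)^{\frac{\mu}{\lambda(\alpha-1)}+1}-1\right]}\right)^{\alpha-1}\bigl(1+\lambda(T-t)\bigr)^{\frac{\mu}{\lambda}}\exp\left(-\alpha\left(\frac{\mu}{\alpha-1}+\lambda\right)\eta(t)\right),$$ and $f_T(T):=0$ (its limit as $t\to T^-$). $x_0$ denotes the unique real solution with $x>1$ of $$(\alpha-1)x^{\frac{\mu}{\lambda}+\alpha-1}-\alpha\left(\frac{\mu}{\lambda(\alpha-1)}+1\right)x^{\alpha-1}+\frac{\mu}{\lambda}=0,$$ and $t_0:=T-\frac{x_0^{\alpha-1}-1}{\lambda}$.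 The abandonment time $t^*$ is defined as follows: if there exists $t\in[0,T]$ with $f_T(t)>\frac{R}{\theta^\alpha}$, then $t^*$ is the infimum of all such $t$; otherwise $t^*=T$. *)

(* Defs.v *)
(* Stdlib real numbers, with Coquelicot for the integral and the infimum. *)
From Stdlib Require Export Reals ClassicalEpsilon.
From Coquelicot Require Export Coquelicot.

Open Scope R_scope.

Definition eta (T alpha lambda mu t : R) : R :=
  RInt (fun s => 1 / (Rpower (1 + lambda * (T - s))
                        (mu / (lambda * (alpha - 1)) + 1) - 1)) 0 t.

(* The value at [T] is the left limit of the formula, where the integral
   [eta] diverges. *)
Definition fT (T alpha lambda mu t : R) : R :=
  if Rlt_dec t T then
    Rpower ((mu + lambda * (alpha - 1)) /
            ((alpha - 1) * (Rpower (1 + lambda * (T - t))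
                              (mu / (lambda * (alpha - 1)) + 1) - 1)))
           (alpha - 1)
    * Rpower (1 + lambda * (T - t)) (mu / lambda)
    * exp (- alpha * (mu / (alpha - 1) + lambda) * eta T alpha lambda mu t)
  else 0.

Definition x0_spec (alpha lambda mu x : R) : Prop :=
  1 < x /\
  (alpha - 1) * Rpower x (mu / lambda + alpha - 1)
  - alpha * (mu / (lambda * (alpha - 1)) + 1) * Rpower x (alpha - 1)
  + mu / lambda = 0.

(* [iota] is definite description: [iota_correct] gives [x0_spec] for this
   number once [exists! x, x0_spec alpha lambda mu x] is known, which holds
   for [1 < alpha] and positive [lambda], [mu]. *)
Definition x0 (alpha lambda mu : R) : R :=
  iota (fun x : R => x0_spec alpha lambda mu x).

Definition t0 (T alpha lambda mu : R) : R :=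
  T - (Rpower (x0 alpha lambda mu) (alpha - 1) - 1) / lambda.

Definition abandon (T theta r alpha lambda mu t : R) : Prop :=
  0 <= t <= T /\ fT T alpha lambda mu t > r / Rpower theta alpha.

Definition tstar (T theta r alpha lambda mu : R) : R :=
  if excluded_middle_informative
       (exists t, abandon T theta r alpha lambda mu t)
  then real (Glb_Rbar (abandon T theta r alpha lambda mu))
  else T.

(* Main.v *)
From Stdlib Require Import Lra.
Require Import Defs.
Open Scope R_scope.

(* With [y = 1 + lambda (T - t)] and [q = mu / (lambda (alpha - 1)) + 1], the
   logarithmic derivative of [fT] at [t] is
   [lambda / (y (y^q - 1)) * crit alpha q y], and the equation defining [x0]
   says that [crit alpha q] vanishes at [x0^(alpha - 1)].  The function
   [crit alpha q] is convex on [y >= 1] and negative at [1], so it changes sign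
   exactly once there, from negative to positive.  As [y] decreases in [t],
   [fT] increases up to [t0] and decreases from [t0] on. *)

(** * The sign of [crit] beyond [1] *)

Definition crit (alpha q y : R) : R :=
  (alpha - 1) * Rpower y q - alpha * q * y + (alpha - 1) * (q - 1).

Lemma Rpower_gt_1 (x p : R) : 1 < x -> 0 < p -> 1 < Rpower x p.
Proof.
intros Hx Hp; rewrite <- (Rpower_O x) by lra; now apply Rpower_lt.
Qed.

Lemma is_derive_crit (alpha q y : R) : 0 < y ->
  is_derive (crit alpha q) y (q * ((alpha - 1) * Rpower y (q - 1) - alpha)).
Proof.
intros Hy; unfold crit, Rpower; auto_derive; [lra|].
(* Turns [y^(q-1)] into [y^q / y], the form in which the computed derivative appears. *)
replace ((q - 1) * ln y) with (q * ln y + - ln y) by ring.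
rewrite exp_plus, exp_Ropp, exp_ln by lra.
field; lra.
Qed.

Lemma crit_MVT (alpha q a b : R) : 0 < a -> a < b ->
  exists c, a < c < b /\ crit alpha q b - crit alpha q a =
    q * ((alpha - 1) * Rpower c (q - 1) - alpha) * (b - a).
Proof.
intros Ha Hab.
destruct (MVT_cor2 (crit alpha q)
  (fun c => q * ((alpha - 1) * Rpower c (q - 1) - alpha)) a b Hab)
  as [c [Hc1 Hc2]].
- intros c Hc; apply is_derive_Reals, is_derive_crit; lra.
- exists c; split; assumption.
Qed.

(** The three terms add up to [- q]. *)
Lemma crit_1_neg (alpha q : R) : 0 < q -> crit alpha q 1 < 0.
Proof.
intros Hq; unfold crit, Rpower; rewrite ln_1, Rmult_0_r, exp_0; lra.
Qed.

(* Convexity: [crit] has climbed between [1] and [a], so its increasing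
   derivative is positive beyond [a]. *)
Lemma crit_pos_after (alpha q a b : R) : 1 < alpha -> 1 < q ->
  1 < a -> a < b -> 0 <= crit alpha q a -> 0 < crit alpha q b.
Proof.
intros Halpha Hq Ha Hab Hca.
pose proof (crit_1_neg alpha q ltac:(lra)) as H1.
destruct (crit_MVT alpha q 1 a) as [c [Hc Ec]]; [lra..|].
destruct (crit_MVT alpha q a b) as [d [Hd Ed]]; [lra..|].
assert (Hcd : Rpower c (q - 1) < Rpower d (q - 1))
  by (apply Rlt_Rpower_l; lra).
assert (Hc' : 0 < (alpha - 1) * Rpower c (q - 1) - alpha).
{ apply Rnot_le_lt; intros Hle.
  assert (0 <= (alpha - (alpha - 1) * Rpower c (q - 1)) * (q * (a - 1)))
    by (apply Rmult_le_pos; [lra|apply Rmult_le_pos; lra]).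
  lra. }
assert (Hd' : 0 < (alpha - 1) * Rpower d (q - 1) - alpha).
{ apply (Rmult_lt_compat_l (alpha - 1)) in Hcd; lra. }
assert (0 < q * ((alpha - 1) * Rpower d (q - 1) - alpha) * (b - a))
  by (apply Rmult_lt_0_compat; [apply Rmult_lt_0_compat|]; lra).
lra.
Qed.

Lemma crit_neg_before (alpha q a b : R) : 1 < alpha -> 1 < q ->
  1 < a -> a < b -> crit alpha q b <= 0 -> crit alpha q a < 0.
Proof.
intros Halpha Hq Ha Hab Hcb; apply Rnot_le_lt; intros Hca.
pose proof (crit_pos_after alpha q a b Halpha Hq Ha Hab Hca); lra.
Qed.

(** Intermediate value theorem between [1], where [crit] is negative, and an explicit point [Y]
    where it is positive. *)
Lemma crit_root (alpha q : R) : 1 < alpha -> 1 < q ->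
  exists y, 1 < y /\ crit alpha q y = 0.
Proof.
intros Halpha Hq.
set (k := alpha * q / (alpha - 1)).
(* [Y^(q-1) = k] cancels the first two terms of [crit alpha q Y]. *)
set (Y := Rpower k (/ (q - 1))).
assert (Hk : 1 < k).
{ unfold k; apply (Rmult_lt_reg_r (alpha - 1)); [lra|].
  unfold Rdiv; rewrite Rmult_assoc, Rinv_l by lra.
  assert (alpha * 1 < alpha * q) by (apply Rmult_lt_compat_l; lra); lra. }
assert (HY : 1 < Y) by (apply Rpower_gt_1; [|apply Rinv_0_lt_compat]; lra).
assert (HYq : Rpower Y q = k * Y).
{ replace q with ((q - 1) + 1) at 1 by ring.
  rewrite Rpower_plus, Rpower_1 by lra.
  unfold Y at 1; rewrite Rpower_mult, Rinv_l, Rpower_1; lra. }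
assert (HcY : 0 < crit alpha q Y).
{ unfold crit; rewrite HYq; unfold k.
  replace ((alpha - 1) * (alpha * q / (alpha - 1) * Y) - alpha * q * Y)
    with 0 by (field; lra).
  assert (0 < (alpha - 1) * (q - 1)) by (apply Rmult_lt_0_compat; lra); lra. }
pose proof (crit_1_neg alpha q ltac:(lra)) as H1.
destruct (Ranalysis5.IVT_interv (crit alpha q) 1 Y) as [y [Hy Ey]]; try lra.
- intros a Ha; apply continuity_pt_filterlim, @ex_derive_continuous.
  eexists; apply is_derive_crit; lra.
- exists y; split; [|assumption].
  destruct (Req_dec y 1) as [->|]; lra.
Qed.

(** * The root [x0] and the time [t0] *)

(** Substitute [y = x^(alpha - 1)] and use [(alpha - 1) * q = mu / lambda + alpha - 1]. *)
Lemma x0_spec_crit (alpha lambda mu x : R) :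
  1 < alpha -> 0 < lambda -> 0 < mu ->
  x0_spec alpha lambda mu x <->
  1 < x /\ crit alpha (mu / (lambda * (alpha - 1)) + 1)
                (Rpower x (alpha - 1)) = 0.
Proof.
intros Halpha Hlambda Hmu; unfold x0_spec, crit; rewrite Rpower_mult.
replace ((alpha - 1) * (mu / (lambda * (alpha - 1)) + 1))
  with (mu / lambda + alpha - 1) by (field; lra).
replace ((alpha - 1) * (mu / (lambda * (alpha - 1)) + 1 - 1))
  with (mu / lambda) by (field; lra).
reflexivity.
Qed.

Lemma q_gt_1 (alpha lambda mu : R) : 1 < alpha -> 0 < lambda -> 0 < mu ->
  1 < mu / (lambda * (alpha - 1)) + 1.
Proof.
intros Halpha Hlambda Hmu.
assert (0 < mu / (lambda * (alpha - 1)))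
  by (apply Rdiv_lt_0_compat; [|apply Rmult_lt_0_compat]; lra).
lra.
Qed.

(** This makes [iota] return an actual root. Since [x^(alpha - 1)] maps the numbers above [1]
    bijectively to themselves, it suffices that [crit] has exactly one root there. *)
Lemma x0_exists_unique (alpha lambda mu : R) :
  1 < alpha -> 0 < lambda -> 0 < mu ->
  exists! x, x0_spec alpha lambda mu x.
Proof.
intros Halpha Hlambda Hmu.
pose proof (q_gt_1 alpha lambda mu Halpha Hlambda Hmu) as Hq.
destruct (crit_root alpha _ Halpha Hq) as [y [Hy Ey]].
assert (Exy : Rpower (Rpower y (/ (alpha - 1))) (alpha - 1) = y)
  by (rewrite Rpower_mult, Rinv_l, Rpower_1; lra).
exists (Rpower y (/ (alpha - 1))); split.
- apply x0_spec_crit; [assumption..|]; rewrite Exy; split; [|assumption].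
  apply Rpower_gt_1; [|apply Rinv_0_lt_compat]; lra.
- intros x Hx; apply x0_spec_crit in Hx; [|assumption..].
  destruct Hx as [Hx Ex].
  assert (Hxp : 1 < Rpower x (alpha - 1)) by (apply Rpower_gt_1; lra).
  assert (E : Rpower x (alpha - 1) = y).
  (* Of two distinct roots above [1], the larger would have positive [crit]. *)
  { destruct (Rtotal_order (Rpower x (alpha - 1)) y) as [H|[H|H]];
      [|assumption|];
      apply (crit_pos_after alpha _ _ _ Halpha Hq) in H; lra. }
  rewrite <- E, Rpower_mult, Rinv_r, Rpower_1; lra.
Qed.

(** At [t0] the base [1 + lambda * (T - t)] equals [x0^(alpha - 1)], a number above [1]. *)
Lemma t0_spec (T alpha lambda mu : R) :
  1 < alpha -> 0 < lambda -> 0 < mu ->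
  t0 T alpha lambda mu < T /\
  crit alpha (mu / (lambda * (alpha - 1)) + 1)
       (1 + lambda * (T - t0 T alpha lambda mu)) = 0.
Proof.
intros Halpha Hlambda Hmu.
assert (Hx : x0_spec alpha lambda mu (x0 alpha lambda mu))
  by (apply (iota_correct (fun x => x0_spec alpha lambda mu x));
      now apply x0_exists_unique).
apply x0_spec_crit in Hx; [|assumption..]; destruct Hx as [Hx Ex].
assert (Hxp : 1 < Rpower (x0 alpha lambda mu) (alpha - 1))
  by (apply Rpower_gt_1; lra).
unfold t0; split.
- assert (0 < (Rpower (x0 alpha lambda mu) (alpha - 1) - 1) / lambda)
    by (apply Rdiv_lt_0_compat; lra).
  lra.
- rewrite <- Ex; f_equal; field; lra.
Qed.

(** * The logarithm of [fT] and its derivative *)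

Lemma base_gt_1 (T lambda t : R) : 0 < lambda -> t < T ->
  1 < 1 + lambda * (T - t).
Proof.
intros Hlambda Ht; assert (0 < lambda * (T - t))
  by (apply Rmult_lt_0_compat; lra); lra.
Qed.

(** Fundamental theorem of calculus: the denominator is positive for [s < T], so the integrand is
    continuous there. Negative [t] are included, which makes the derivative at [0] two-sided. *)
Lemma is_derive_eta (T alpha lambda mu t : R) :
  0 < T -> 1 < alpha -> 0 < lambda -> 0 < mu -> t < T ->
  is_derive (eta T alpha lambda mu) t
    (1 / (Rpower (1 + lambda * (T - t)) (mu / (lambda * (alpha - 1)) + 1) - 1)).
Proof.
intros HT Halpha Hlambda Hmu Ht.
pose proof (q_gt_1 alpha lambda mu Halpha Hlambda Hmu) as Hq.
set (q := mu / (lambda * (alpha - 1)) + 1) in *.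
set (g := fun s => 1 / (Rpower (1 + lambda * (T - s)) q - 1)).
assert (Hg : forall s, s < T -> continuous g s).
{ intros s Hs; apply @ex_derive_continuous; unfold g, Rpower.
  pose proof (base_gt_1 T lambda s Hlambda Hs) as Hb.
  pose proof (Rpower_gt_1 _ q Hb ltac:(lra)) as Hbq; unfold Rpower in Hbq.
  auto_derive; repeat split; unfold Rminus in *; lra. }
apply (is_derive_RInt g (eta T alpha lambda mu) 0 t); [|now apply Hg].
apply (filter_imp (fun x => x < T)); [|now apply open_lt].
intros x Hx; apply @RInt_correct, @ex_RInt_continuous.
intros z [_ Hz]; apply Hg.
(* Both ends of the interval of integration, [0] and [x], lie below [T]. *)
revert Hz; apply Rmax_case; lra.
Qed.

Definition log_fT (T alpha lambda mu t : R) : R :=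
  (alpha - 1) *
    (ln ((mu + lambda * (alpha - 1)) / (alpha - 1)) -
     ln (Rpower (1 + lambda * (T - t)) (mu / (lambda * (alpha - 1)) + 1) - 1))
  + mu / lambda * ln (1 + lambda * (T - t))
  + - alpha * (mu / (alpha - 1) + lambda) * eta T alpha lambda mu t.

Lemma fT_exp (T alpha lambda mu t : R) :
  1 < alpha -> 0 < lambda -> 0 < mu -> t < T ->
  fT T alpha lambda mu t = exp (log_fT T alpha lambda mu t).
Proof.
intros Halpha Hlambda Hmu Ht; unfold fT, log_fT.
destruct (Rlt_dec t T) as [_|]; [|contradiction].
pose proof (q_gt_1 alpha lambda mu Halpha Hlambda Hmu) as Hq.
pose proof (Rpower_gt_1 _ _ (base_gt_1 T lambda t Hlambda Ht)
  (Rlt_trans _ _ _ Rlt_0_1 Hq)) as Hb.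
assert (0 < lambda * (alpha - 1)) by (apply Rmult_lt_0_compat; lra).
rewrite <- ln_div by (try apply Rdiv_lt_0_compat; lra).
rewrite !exp_plus; f_equal; f_equal.
unfold Rpower at 1; do 3 f_equal; field; lra.
Qed.

Lemma fT_pos (T alpha lambda mu t : R) :
  1 < alpha -> 0 < lambda -> 0 < mu -> t < T -> 0 < fT T alpha lambda mu t.
Proof. intros; rewrite fT_exp by assumption; apply exp_pos. Qed.

(** Since [mu / (alpha - 1) + lambda = lambda * q] and [mu = lambda * (alpha - 1) * (q - 1)], the
    three terms over the common denominator [y * (y^q - 1)] have numerator
    [lambda * crit alpha q y]. *)
Lemma is_derive_log_fT (T alpha lambda mu t : R) :
  0 < T -> 1 < alpha -> 0 < lambda -> 0 < mu -> t < T ->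
  is_derive (log_fT T alpha lambda mu) t
    (let y := 1 + lambda * (T - t) in
     let q := mu / (lambda * (alpha - 1)) + 1 in
     lambda / (y * (Rpower y q - 1)) * crit alpha q y).
Proof.
intros HT Halpha Hlambda Hmu Ht; cbv zeta.
pose proof (q_gt_1 alpha lambda mu Halpha Hlambda Hmu) as Hq.
pose proof (is_derive_eta T alpha lambda mu t HT Halpha Hlambda Hmu Ht) as He.
pose proof (base_gt_1 T lambda t Hlambda Ht) as Hb.
pose proof (Rpower_gt_1 _ _ Hb (Rlt_trans _ _ _ Rlt_0_1 Hq)) as Hbq.
unfold log_fT.
evar_last.
- apply @is_derive_plus; [|apply @is_derive_scal; exact He].
  unfold Rpower in *; auto_derive.
  2: reflexivity.
  repeat split; unfold Rminus in *; lra.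
- unfold plus, scal, mult; simpl; unfold mult; simpl.
  change (T + - t) with (T - t).
  fold (Rpower (1 + lambda * (T - t)) (mu / (lambda * (alpha - 1)) + 1)).
  unfold crit.
  (* With [y^q] abstracted as [P], the identity is rational, and [y] and [P - 1] are nonzero. *)
  set (P := Rpower _ _) in *.
  set (y := 1 + lambda * (T - t)) in *.
  field; repeat split; lra.
Qed.

Lemma fT_continuity_pt (T alpha lambda mu t : R) :
  0 < T -> 1 < alpha -> 0 < lambda -> 0 < mu -> t < T ->
  continuity_pt (fT T alpha lambda mu) t.
Proof.
intros HT Halpha Hlambda Hmu Ht; apply continuity_pt_filterlim.
apply (continuous_ext_loc _ (fun s => exp (log_fT T alpha lambda mu s))).
- apply (filter_imp (fun s => s < T)); [|now apply open_lt].
  intros s Hs; symmetry; now apply fT_exp.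
- apply @ex_derive_continuous, @ex_derive_comp.
  + eexists; apply is_derive_exp.
  + eexists; now apply is_derive_log_fT.
Qed.

(** Mean value theorem with every positive factor collected in [k], so that the sign of the
    increment is that of [crit] at an intermediate time. *)
Lemma log_fT_MVT (T alpha lambda mu s t : R) :
  0 < T -> 1 < alpha -> 0 < lambda -> 0 < mu -> s < t -> t < T ->
  exists u k, s < u < t /\ 0 < k /\
    log_fT T alpha lambda mu t - log_fT T alpha lambda mu s =
    k * crit alpha (mu / (lambda * (alpha - 1)) + 1) (1 + lambda * (T - u)).
Proof.
intros HT Halpha Hlambda Hmu Hst Ht.
destruct (MVT_cor2 (log_fT T alpha lambda mu) _ s t Hst
  (fun u Hu => proj1 (is_derive_Reals _ _ _)
     (is_derive_log_fT T alpha lambda mu u HT Halpha Hlambda Hmu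
        (Rle_lt_trans _ _ _ (proj2 Hu) Ht)))) as [u [Eu Hu]].
pose proof (q_gt_1 alpha lambda mu Halpha Hlambda Hmu) as Hq.
pose proof (base_gt_1 T lambda u Hlambda ltac:(lra)) as Hb.
pose proof (Rpower_gt_1 _ _ Hb (Rlt_trans _ _ _ Rlt_0_1 Hq)) as Hbq.
(* Unification finds [k] to be [lambda / (y * (y^q - 1)) * (t - s)], with [y] the base at [u]. *)
exists u; eexists; split; [exact Hu|split].
2: rewrite Eu; cbv zeta; rewrite Rmult_assoc, (Rmult_comm (crit _ _ _)),
     <- Rmult_assoc; reflexivity.
apply Rmult_lt_0_compat; [|lra].
apply Rdiv_lt_0_compat; [|apply Rmult_lt_0_compat]; lra.
Qed.

(** * Monotonicity of [fT] on either side of [t0] *)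

Lemma fT_increasing (T alpha lambda mu s t : R) :
  0 < T -> 1 < alpha -> 0 < lambda -> 0 < mu ->
  s < t -> t <= t0 T alpha lambda mu ->
  fT T alpha lambda mu s < fT T alpha lambda mu t.
Proof.
intros HT Halpha Hlambda Hmu Hst Ht.
destruct (t0_spec T alpha lambda mu Halpha Hlambda Hmu) as [H0 E0].
rewrite !fT_exp by lra; apply exp_increasing.
destruct (log_fT_MVT T alpha lambda mu s t) as [u [k [Hu [Hk E]]]]; try lra.
(* The base decreases in time, so before [t0] it lies beyond the root of [crit]. *)
assert (0 < crit alpha (mu / (lambda * (alpha - 1)) + 1) (1 + lambda * (T - u))).
{ apply (crit_pos_after alpha _ (1 + lambda * (T - t0 T alpha lambda mu)));
    [assumption|now apply q_gt_1|now apply base_gt_1| |lra].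
  apply Rplus_lt_compat_l, Rmult_lt_compat_l; lra. }
pose proof (Rmult_lt_0_compat _ _ Hk H); lra.
Qed.

Lemma fT_decreasing (T alpha lambda mu s t : R) :
  0 < T -> 1 < alpha -> 0 < lambda -> 0 < mu ->
  t0 T alpha lambda mu <= s -> s < t -> t <= T ->
  fT T alpha lambda mu t < fT T alpha lambda mu s.
Proof.
intros HT Halpha Hlambda Hmu Hs Hst Ht.
destruct (t0_spec T alpha lambda mu Halpha Hlambda Hmu) as [H0 E0].
destruct (Req_dec t T) as [->|HtT].
{ unfold fT at 1; destruct (Rlt_dec T T); [lra|]; apply fT_pos; lra. }
rewrite !fT_exp by lra; apply exp_increasing.
destruct (log_fT_MVT T alpha lambda mu s t) as [u [k [Hu [Hk E]]]]; try lra.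
assert (crit alpha (mu / (lambda * (alpha - 1)) + 1) (1 + lambda * (T - u)) < 0).
{ apply (crit_neg_before alpha _ _ (1 + lambda * (T - t0 T alpha lambda mu)));
    [assumption|now apply q_gt_1|apply base_gt_1; lra| |lra].
  apply Rplus_lt_compat_l, Rmult_lt_compat_l; lra. }
pose proof (Rmult_lt_compat_l _ _ _ Hk H); lra.
Qed.

(** * Evaluating [tstar] *)

(** The hypotheses characterize [m] as the infimum; the second also provides a member, which selects
    the infimum branch of [tstar]. *)
Lemma tstar_eq_inf (T theta r alpha lambda mu m : R) :
  (forall t, abandon T theta r alpha lambda mu t -> m <= t) ->
  (forall b, m < b -> exists t, abandon T theta r alpha lambda mu t /\ t < b) ->
  tstar T theta r alpha lambda mu = m.
Proof.
intros Hlow Happ; unfold tstar.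
destruct (Happ (m + 1) ltac:(lra)) as [t1 [Ht1 _]].
destruct (excluded_middle_informative _) as [_|Hn];
  [|now destruct Hn; exists t1].
rewrite (is_glb_Rbar_unique _ (Finite m)); [reflexivity|split].
- intros t Ht; exact (Hlow t Ht).
- intros [b| |] Hb; simpl.
  + apply Rnot_lt_le; intros Hmb.
    destruct (Happ b Hmb) as [t [Ht Htb]].
    pose proof (Hb t Ht) as Hbt; simpl in Hbt; lra.
  (* The real member [t1] prevents [+oo] from being a lower bound. *)
  + exact (Hb t1 Ht1).
  + exact I.
Qed.

Lemma tstar_eq_0 (T theta r alpha lambda mu : R) : 0 < T ->
  fT T alpha lambda mu 0 > r / Rpower theta alpha ->
  tstar T theta r alpha lambda mu = 0.
Proof.
intros HT H; apply tstar_eq_inf.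
- intros t [Ht _]; lra.
- intros b Hb; exists 0; split; [split|]; lra.
Qed.

Lemma tstar_eq_T (T theta r alpha lambda mu : R) :
  (forall t, 0 <= t <= T -> fT T alpha lambda mu t <= r / Rpower theta alpha) ->
  tstar T theta r alpha lambda mu = T.
Proof.
intros H; unfold tstar.
destruct (excluded_middle_informative _) as [[t [Ht Hf]]|_]; [|reflexivity].
specialize (H t Ht); lra.
Qed.

Theorem theorem5 (T theta r alpha lambda mu : R)
  (hT : 0 < T) (htheta : 0 < theta) (hr : 0 < r)
  (halpha : 1 < alpha) (hlambda : 0 < lambda) (hmu : 0 < mu) :
  (t0 T alpha lambda mu <= 0 ->
     (fT T alpha lambda mu 0 > r / Rpower theta alpha ->
        tstar T theta r alpha lambda mu = 0) /\
     (~ fT T alpha lambda mu 0 > r / Rpower theta alpha ->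
        tstar T theta r alpha lambda mu = T))
  /\
  (t0 T alpha lambda mu > 0 ->
     (fT T alpha lambda mu 0 > r / Rpower theta alpha ->
        tstar T theta r alpha lambda mu = 0) /\
     (fT T alpha lambda mu 0 <= r / Rpower theta alpha
        < fT T alpha lambda mu (t0 T alpha lambda mu) ->
        exists t',
          unique (fun t => 0 <= t <= t0 T alpha lambda mu /\
                           fT T alpha lambda mu t = r / Rpower theta alpha) t' /\
          tstar T theta r alpha lambda mu = t') /\
     (~ fT T alpha lambda mu 0 > r / Rpower theta alpha ->
      ~ (fT T alpha lambda mu 0 <= r / Rpower theta alpha
           < fT T alpha lambda mu (t0 T alpha lambda mu)) ->
        tstar T theta r alpha lambda mu = T)).
Proof.
pose proof (fT_increasing T alpha lambda mu) as Hinc.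
pose proof (fT_decreasing T alpha lambda mu) as Hdec.
destruct (t0_spec T alpha lambda mu halpha hlambda hmu) as [H0T _].
set (f := fT T alpha lambda mu) in *.
set (c := r / Rpower theta alpha) in *.
set (tm := t0 T alpha lambda mu) in *.
split; intros Htm; (split; [now apply tstar_eq_0|]).
- intros H0; apply tstar_eq_T; intros t Ht; fold f c.
  (* Here [tm <= 0], so [f] decreases on all of [[0, T]] and is largest at [0]. *)
  destruct (Req_dec t 0) as [->|Hne]; [lra|].
  assert (f t < f 0) by (apply Hdec; lra); lra.
- split.
  + intros [Hc0 Hcm].
    assert (Ht' : exists t', 0 <= t' <= tm /\ f t' = c).
    (* Equality at [0] is set apart because [IVT_interv] asks for strict signs at both ends. *)
    { destruct (Req_dec (f 0) c) as [E|Hne]; [exists 0; split; lra|].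
      destruct (Ranalysis5.IVT_interv (fun t => f t - c) 0 tm)
        as [t' [Ht' E]]; try lra.
      - intros a Ha; apply continuity_pt_minus;
          [apply fT_continuity_pt; lra|].
        apply continuity_pt_const; intros x y; reflexivity.
      - exists t'; split; lra. }
    destruct Ht' as [t' [Ht' E]].
    exists t'; split.
    * split; [now split|]; intros x [Hx Ex].
      destruct (Rtotal_order t' x) as [H|[H|H]]; [|assumption|];
        apply Hinc in H; lra.
    (* Strictness leaves room to the right of [t'] where [f] is still increasing, hence above
       [c]. *)
    * assert (t' < tm) by (destruct (Req_dec t' tm) as [->|]; lra).
      apply tstar_eq_inf; fold f c.
      -- intros t [Ht Hft]; apply Rnot_lt_le; intros Hlt.
         apply Hinc in Hlt; try lra.
         unfold f, c in *; lra.
      (* The midpoint of [t'] and [Rmin b tm] is below [b] and still in the increasing range. *)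
      -- intros b Hb; exists ((t' + Rmin b tm) / 2).
         assert (t' < Rmin b tm) by (apply Rmin_glb_lt; lra).
         pose proof (Rmin_l b tm); pose proof (Rmin_r b tm).
         split; [split; [lra|]|lra].
         fold f c; rewrite <- E; apply Hinc; lra.
  + intros H0 Hm; apply tstar_eq_T; intros t Ht; fold f c.
    (* Given [f 0 <= c], failure of the middle case bounds the peak value [f tm], hence all of [f]
       on [[0, T]]. *)
    assert (Hfm : f tm <= c) by (apply Rnot_lt_le; intros H; apply Hm; lra).
    destruct (Rtotal_order t tm) as [H|[->|H]]; [|lra|].
    * apply Hinc in H; lra.
    * apply Hdec in H; lra.
Qed.
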